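(* Let $G$ be a finite simple graph on $n$ vertices and let $\ell$ be an integer with $2\le\ell\le n-3$. Then $\ell+2\le \mathrm{Z}_{(\ell)}(G)$.
   Context: Zero forcing color change rule: a blue vertex $u$ may force (color blue) a white vertex $v$ if $v$ is the only white neighbor of $u$. A leak is a vertex that is not allowed to perform a force. For an integer $0\le \ell\le |V(G)|$, a set $B\subseteq V(G)$ is an $\ell$-leaky forcing set of $G$ if, for every set $L\subseteq V(G)$ with $|L|=\ell$, starting with exactly $B$ blue (all others white) and iteratively applying the color change rule, with vertices of $L$ not allowed to force, eventually colors all of $V(G)$ blue. $\mathrm{Z}_{(\ell)}(G)$ is the minimum size of an $\ell$-leaky forcing set of $G$. *)

(* Defs.v *)
From mathcomp Require Import all_boot.

Set Implicit Arguments.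
Unset Strict Implicit.
Unset Printing Implicit Defensive.

(* A finite simple graph on the vertex type T is a symmetric irreflexive
   relation e : rel T.  A colouring is given by its set X of blue vertices. *)

Section LeakyForcing.

Variables (T : finType) (e : rel T).

Definition may_force (X : {set T}) (u v : T) : bool :=
  (u \in X) && ([set w | e u w & w \notin X] == [set v]).

Definition leaky_step (L : {set T}) : rel {set T} :=
  fun X Y => [exists u, exists v,
    [&& u \notin L, may_force X u v & Y == v |: X]].

(* [connect] is the reflexive transitive closure.  Forces that are available
   remain available as the blue set grows (until performed), so the order of
   the forces is immaterial: "some sequence of forces turns V(G) blue" and
   "the process eventually turns V(G) blue" are the same condition. *)
Definition leaky_forcing (l : nat) (B : {set T}) : bool :=
  [forall L : {set T}, (#|L| == l) ==> connect (leaky_step L) B [set: T]].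

(* The minimum ranges over a nonempty family, by leaky_forcingT below. *)
Definition leaky_number (l : nat) : nat :=
  #|[arg min_(B < [set: T] | leaky_forcing l B) #|B| ]|.

Lemma leaky_forcingT (l : nat) : leaky_forcing l [set: T].
Proof. by apply/forallP => L; rewrite connect0 implybT. Qed.

Lemma leaky_numberP (l : nat) :
  (exists2 B : {set T}, leaky_forcing l B & #|B| = leaky_number l) /\
  (forall B : {set T}, leaky_forcing l B -> leaky_number l <= #|B|).
Proof.
rewrite /leaky_number; case: arg_minnP; first exact: leaky_forcingT.
by move=> B lB minB; split; first exists B.
Qed.

End LeakyForcing.

(* Main.v *)
(** A leaky forcing set with at most [l] vertices is stuck when all of it leaks.
Suppose that [B] is [l]-leaky forcing, [#|B| = l.+1] and [l >= 2].  Letting all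
of [B] but [b] leak, [b] must force first, so it has a unique neighbour [f b]
outside [B]; the next force is then made by [f b], which therefore has a unique
neighbour outside [B] too.  If [f b1 = f b2], the leaks [f b1] and
[B :\ b1 :\ b2] stop the process.  So [f] is injective and takes at least three
values.  With [B :\ b] leaking, the process is a single chain starting at [f b],
which stops at the next value of [f] that it meets, so it never colours all
three. *)

Require Import Defs.
From mathcomp Require Import all_boot.

Lemma set_card_extend (T : finType) (A : {set T}) (k : nat) :
  #|A| <= k <= #|T| -> exists2 C : {set T}, A \subset C & #|C| = k.
Proof.
case/andP=> leAk lekT.
elim: k leAk lekT => [|k IHk]; first by exists A => //; apply/eqP; rewrite -leqn0.
rewrite leq_eqVlt => /predU1P[<- _|ltAk ltkT]; first by exists A.
have [C sAC cardC] := IHk ltAk (ltnW ltkT).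
have [x xC] : exists x, x \in ~: C.
  by apply/card_gt0P; rewrite cardsCs setCK cardC subn_gt0.
exists (x |: C); first exact: subset_trans sAC (subsetUr _ _).
by rewrite cardsU1 cardC; move: xC; rewrite inE => ->.
Qed.

Section LeakyForcing.

Set Implicit Arguments.
Unset Strict Implicit.

Variables (T : finType) (e : rel T).
Implicit Types (L X Y B : {set T}) (u v b : T).

Definition nbr_out X u : {set T} := [set w | e u w & w \notin X].

Lemma nbr_outS X Y u : X \subset Y -> nbr_out Y u \subset nbr_out X u.
Proof.
move=> sXY; apply/subsetP=> w; rewrite !inE => /andP[-> /=].
exact: contra (subsetP sXY w).
Qed.

Lemma nbr_outU1 X u v : nbr_out X u = [set v] -> nbr_out (v |: X) u = set0.
Proof.
move=> outu; apply/setP=> w; rewrite !inE negb_or.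
have /setP/(_ w) := outu; rewrite !inE => <-.
by case: (e u w); case: (w \in X).
Qed.

Lemma nbr_out_notin X u v : nbr_out X u = [set v] -> v \notin X.
Proof. by move=> outu; have := set11 v; rewrite -outu inE => /andP[]. Qed.

Lemma leaky_connect_ind L (P : {set T} -> Prop) B Z :
    (forall X u v, P X -> u \notin L -> u \in X ->
       nbr_out X u = [set v] -> P (v |: X)) ->
  P B -> connect (leaky_step e L) B Z -> P Z.
Proof.
move=> stepP PB /connectP[p]; elim: p B PB => [|Y p IHp] B PB /=; first by move=> _ ->.
case/andP=> /existsP[u /existsP[v /and3P[uL /andP[uB /eqP outu] /eqP->]]].
by apply: IHp; apply: stepP outu.
Qed.

(** Extra leaks only restrict the process, so [L] may be enlarged to exactly [l] vertices. A process
    from [B] that leaves [X] makes a first force out of [X]; its target is then also the only white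
    neighbour of the forcing vertex when all of [X] is blue. *)
Lemma leaky_forcing_progress l B L X :
    leaky_forcing e l B -> #|L| <= l <= #|T| -> B \subset X -> X != setT ->
  exists u v, [/\ u \notin L, u \in X & nbr_out X u = [set v]].
Proof.
move=> /forallP forceB /set_card_extend[L' sLL' /eqP cardL'] sBX XnT.
have /implyP/(_ cardL') BT := forceB L'.
have [/existsP[u /existsP[v /and3P[uL' uX /eqP outu]]]|noforce] :=
  boolP [exists u, exists v, [&& u \notin L', u \in X & nbr_out X u == [set v]]].
  by exists u, v; split=> //; apply: contra (subsetP sLL' u) uL'.
suff: [set: T] \subset X by rewrite subTset (negPf XnT).
apply: (leaky_connect_ind (P := fun Y => Y \subset X) _ sBX BT) => Y u v sYX uL' uY outu.
rewrite subUset sYX andbT sub1set; apply: contraR noforce => vX.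
apply/existsP; exists u; apply/existsP; exists v.
rewrite uL' (subsetP sYX) //= eqEsubset -{1}outu nbr_outS //= sub1set inE vX andbT.
by have := set11 v; rewrite -outu inE => /andP[].
Qed.

Section SmallForcingSet.

Variables (l : nat) (B : {set T}).
Hypotheses (e_irr : irreflexive e) (e_sym : symmetric e).
Hypotheses (forceB : leaky_forcing e l B) (cardB : #|B| = l.+1).
Hypothesis (ltlT : l.+2 < #|T|).

Let lelT : l <= #|T|. Proof. exact: ltnW (ltnW (ltnW ltlT)). Qed.

Let cardBD1 b : b \in B -> #|B :\ b| = l.
Proof. by move=> bB; move: cardB; rewrite (cardsD1 b) bB => -[]. Qed.

Let neqT X : #|X| <= l.+2 -> X != setT.
Proof.
by apply: contraTneq => ->; rewrite cardsT -ltnNge.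
Qed.

Lemma nbr_out_forcing b : b \in B -> exists v, nbr_out B b = [set v].
Proof.
move=> bB.
have [||u [v [uL uB outu]]] := leaky_forcing_progress (L := B :\ b) forceB _ (subxx B).
- by rewrite cardBD1 // leqnn.
- by rewrite neqT // cardB.
by exists v; move: uL; rewrite !inE uB andbT negbK => /eqP<-.
Qed.

(** With [B :\ b] leaking, [b] is exhausted after forcing [v], so the next force is made by [v].
    Having no loop, [v] has the same neighbours outside [B] as outside [v |: B]. *)
Lemma nbr_out_forced b v : b \in B -> nbr_out B b = [set v] ->
  exists w, nbr_out B v = [set w].
Proof.
move=> bB outb; have vB := nbr_out_notin outb.
have [|||u [w [uL uX outu]]] := leaky_forcing_progress (L := B :\ b) (X := v |: B) forceB.
- by rewrite cardBD1 // leqnn.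
- exact: subsetUr.
- by rewrite neqT // cardsU1 vB cardB.
exists w; move: uX uL outu; rewrite !inE => /orP[/eqP->|uB].
  move=> _ <-; apply/setP=> x; rewrite !inE negb_or.
  by case: eqP => [->|]; rewrite ?e_irr.
rewrite uB andbT negbK => /eqP-> /setP/(_ w).
by rewrite (nbr_outU1 outb) !inE eqxx.
Qed.

Lemma nbr_out_inj b1 b2 v : b1 \in B -> b2 \in B ->
  nbr_out B b1 = [set v] -> nbr_out B b2 = [set v] -> b1 = b2.
Proof.
move=> b1B b2B out1 out2; apply/eqP; apply/negPn/negP=> b12.
have vB := nbr_out_notin out1.
have [|||u [w [uL uX outu]]] :=
  leaky_forcing_progress (L := v |: (B :\ b1 :\ b2)) (X := v |: B) forceB.
(* The leaks number [1 + (l + 1 - 2) = l]. *)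
- rewrite cardsU1 !inE (negPf vB) !andbF /= add1n lelT andbT.
  have := cardBD1 b1B; rewrite (cardsD1 b2) !inE b2B eq_sym b12 /=.
  by rewrite add1n => ->.
- exact: subsetUr.
- by rewrite neqT // cardsU1 vB cardB.
suff out0 : nbr_out (v |: B) u = set0.
  by have := set11 w; rewrite -outu out0 inE.
(* Only [b1] and [b2] do not leak, and [v] was the last white neighbour of each. *)
move: uX uL; rewrite !inE; case: eqP => //= _ ->; rewrite andbT negb_and !negbK.
by case/orP=> /eqP->; apply: nbr_outU1.
Qed.

Lemma small_forcing_set_card : #|B| <= 2.
Proof.
have [b bB] : exists b, b \in B by apply/card_gt0P; rewrite cardB.
have /fin_all_exists[f fP] u : exists v, u \in B -> nbr_out B u = [set v].
  case: (boolP (u \in B)) => [/nbr_out_forcing[v outu]|_]; last by exists u.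
  by exists v.
pose F := f @: B.
have <- : #|F| = #|B|.
  by apply: card_in_imset => x y xB yB fxy;
    apply: (nbr_out_inj (v := f x)) => //; [exact: fP|rewrite fxy; exact: fP].
have FB u : u \in F -> u \notin B.
  by case/imsetP=> x xB ->; apply: nbr_out_notin (fP x xB).
(* Invariant of the chain: [t] is its end, the only vertex that may still force,
   and it is stuck as well once [X] contains two values of [f]. *)
pose J X := X = B \/ [/\ B \subset X, f b \in X, #|X :&: F| <= 2 &
   exists t, forall u, u \in X -> u \notin B :\ b ->
     (u != t) || (1 < #|X :&: F|) -> nbr_out X u = set0].
have JT : J setT.
  have /forallP/(_ (B :\ b)) := forceB; rewrite cardBD1 // eqxx /=.
  move=> BT; apply: (leaky_connect_ind (P := J) _ _ BT); last by left.
  (* From [B] the only possible force is that of [b] on [f b], which is then the only blue vertex of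
     [F], since [F] misses [B]. *)
  move=> X u v [->|[sBX fbX cardXF [t tP]]] uL uX outu; right.
    have ub: u = b by apply/eqP; move: uL; rewrite !inE uX andbT negbK.
    move: outu; rewrite ub fP // => /set1_inj <-.
    have c1 : #|(f b |: B) :&: F| = 1.
      apply/eqP/cards1P; exists (f b); apply/setP=> x; rewrite !inE.
      case: eqP => [->|_ /=]; first by rewrite imset_f.
      by apply/andP=> -[xB /FB]; rewrite xB.
    split; rewrite ?c1 ?subsetUr ?setU11 //.
    exists (f b) => x; rewrite !inE orbF; case: eqP => //= _ ->.
    by rewrite andbT negbK => /eqP-> _; apply: nbr_outU1; apply: fP.
  have vX := nbr_out_notin outu.
  (* The only non-leaking vertex of [B] is [b], whose single neighbour outside [B] is already
     blue. *)
  have [euv uB]: e u v /\ u \notin B.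
    have : v \in nbr_out X u by rewrite outu set11.
    rewrite inE => /andP[euv _]; split=> //; apply/negP=> uB.
    have ub: u = b by apply/eqP; move: uL; rewrite !inE uB andbT negbK.
    have: v \in nbr_out B u by rewrite inE euv (contra (subsetP sBX v)).
    by rewrite ub fP // inE => /eqP vfb; rewrite vfb fbX in vX.
  have nz : nbr_out X u <> set0.
    by move=> o; have := set11 v; rewrite -outu o inE.
  (* By the invariant only [t] can force, and only while [X] contains at most one value of [f]. *)
  have /norP[/negPn/eqP ut c1] : ~~ ((u != t) || (1 < #|X :&: F|)).
    by apply/negP=> /(tP u uX uL).
  have cU : #|(v |: X) :&: F| = (v \in F) + #|X :&: F|.
    case: (boolP (v \in F)) => vF; rewrite setIUl.
      have/setIidPl-> : [set v] \subset F by rewrite sub1set.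
      by rewrite cardsU1 inE (negPf vX).
    rewrite (_ : [set v] :&: F = set0) ?set0U //.
    by apply/setP=> x; rewrite !inE; case: eqP => // ->; apply/negbTE.
  split; rewrite ?cU ?inE ?fbX ?orbT //.
  - exact: subset_trans sBX (subsetUr _ _).
  - by move: c1; case: (v \in F); case: #|_| => [|[]].
  exists v => x; rewrite in_setU1; case: (eqVneq x v) => [-> _ _ /=|xv /= xX xL _].
    (* If [v] is a value of [f], its unique neighbour outside [B] is the blue vertex [u], so the
       chain stops at [v]. Otherwise [v |: X] still contains at most one value, and the invariant
       asks nothing of [v]. *)
    case: (boolP (v \in F)) c1 => [/imsetP[y yB vfy] _ _|_ /negPf-> //].
    have [w outv] : exists w, nbr_out B v = [set w].
      by apply: (nbr_out_forced yB) => //; rewrite vfy fP.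
    have uw : u = w.
      by apply/eqP; rewrite -in_set1 -outv inE e_sym euv.
    apply/eqP; rewrite -subset0; apply/subsetP=> z zo.
    have := subsetP (nbr_outS v (subset_trans sBX (subsetUr [set v] X))) z zo.
    rewrite outv inE -uw => /eqP zu; move: zo.
    by rewrite zu !inE uX orbT andbF.
  (* The vertex [u] has just spent its force; the others were stuck before. *)
  case: (eqVneq x u) => [->|xu]; first exact: nbr_outU1.
  apply/eqP; rewrite -subset0 -(tP x xX xL); first exact: nbr_outS (subsetUr _ _).
  by rewrite -ut xu.
(* At [setT] the second alternative bounds [F] itself, and the first contradicts the size of [B]. *)
case: JT => [BT|[_ _]]; last by rewrite setTI.
by have := @neqT B; rewrite cardB -BT eqxx => /(_ (leqnSn _)).
Qed.

End SmallForcingSet.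

End LeakyForcing.

Theorem theorem2p9 (T : finType) (e : rel T) (l : nat)
  (e_sym : symmetric e) (e_irr : irreflexive e)
  (hl2 : 2 <= l) (hln : l + 3 <= #|T|) :
  l + 2 <= leaky_number e l.
Proof.
have ltlT : l.+2 < #|T| by rewrite -addn3.
have [[B forceB <-] _] := leaky_numberP e l.
rewrite addn2 ltnNge; apply/negP; rewrite leq_eqVlt => /predU1P[cardB|leBl].
  have := small_forcing_set_card e_irr e_sym forceB cardB ltlT.
  by rewrite cardB ltnNge hl2.
(* Here [B] has at most [l] vertices, so all of them may leak and no first force exists. *)
have [|||u [v [uB /idP]]] := leaky_forcing_progress (L := B) (X := B) forceB.
- by rewrite -ltnS leBl (leq_trans _ ltlT) // -addn3 leq_addr.
- exact: subxx.
- apply: contraTneq leBl => ->; rewrite cardsT -leqNgt.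
  exact: ltnW (ltnW ltlT).
by rewrite (negPf uB).
Qed.
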